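(* Let $q$ be a prime power, $n$ a positive integer and $m\geq 3$ an integer. Let $\mathbf{A}=(\alpha_1,\dots,\alpha_m)\in(\mathbb{F}_{q^n}^* )^m$ be such that $K_{\mathbf{A}}:=\alpha_1^{q^{m-1}}\alpha_2\alpha_3^{q}\cdots\alpha_m^{q^{m-2}}$ is not a $(1+q+\cdots+q^{m-1})$-th power in $\mathbb{F}_{q^n}$. Then the $\mathbb{F}_q$-subspace $$V_{\mathbf{A},1}:=\{(x_1,\dots,x_m,\;x_1^{q}+\alpha_2x_2^{q^2},\;x_2^{q}+\alpha_3x_3^{q^2},\dots,\;x_{m-1}^{q}+\alpha_mx_m^{q^2},\;x_m^{q}+\alpha_1x_1^{q^2}) : (x_1,\dots,x_m)\in\mathbb{F}_{q^n}^m\}\subseteq\mathbb{F}_{q^n}^{2m}$$ is $(2,4)$-evasive.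
   Context: Let $h<k$ and $h\leq r$ be positive integers. An $\mathbb{F}_q$-subspace $U\subseteq\mathbb{F}_{q^n}^k$ is $(h,r)$-evasive if for every $h$-dimensional $\mathbb{F}_{q^n}$-subspace $H\subseteq\mathbb{F}_{q^n}^k$ one has $\dim_{\mathbb{F}_q}(U\cap H)\leq r$. *)

(* Defs.v *)
From HB Require Import structures.
From mathcomp Require Import all_boot all_order all_algebra all_field.

Set Implicit Arguments.
Unset Strict Implicit.
Unset Printing Implicit Defensive.

Import GRing.Theory.
Local Open Scope ring_scope.

(* Throughout, F is F_q with q = #|F|, and L is F_{q^n} with n = \dim {:L}.   *)
(* The space L^k is represented by {ffun 'I_k -> L}: this type is canonically *)
(* an F-vector space, while {ffun 'I_k -> L^o} is the same type seen as an    *)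
(* L-vector space.                                                            *)

Lemma span_subset (K : fieldType) (vT : vectType K) (P : pred vT) (X : seq vT) :
    P 0 -> (forall c x y, P x -> P y -> P (c *: x + y)) ->
  {in X, forall x, P x} -> forall v, v \in <<X>>%VS -> P v.
Proof.
move=> P0 PD PX v /(coord_span (X := in_tuple X))->.
apply: (big_rec P) => // i x _ Px; apply: PD => //.
by apply: PX; exact: mem_nth.
Qed.

Section Evasive.
Variables (F : fieldType) (L : fieldExtType F) (k : nat).

(* Restriction of scalars from L to F: it has the same elements as H, see     *)
(* mem_restr_scal.                                                            *)
Definition restr_scal (H : {vspace {ffun 'I_k -> L^o}}) :
    {vspace {ffun 'I_k -> L}} :=
  <<([seq a *: b | a <- vbasis {:L}, b <- vbasis H]
       : seq {ffun 'I_k -> L})>>%VS.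

Lemma mem_restr_scal (H : {vspace {ffun 'I_k -> L^o}}) (v : {ffun 'I_k -> L}) :
  (v \in restr_scal H) = ((v : {ffun 'I_k -> L^o}) \in H).
Proof.
have scE (c : F) (a : L) (b : {ffun 'I_k -> L^o}) :
    (c *: ((a *: b : {ffun 'I_k -> L^o}) : {ffun 'I_k -> L}))
    = ((c *: a) *: b : {ffun 'I_k -> L^o}) :> {ffun 'I_k -> L}.
  by apply/ffunP=> i; rewrite !ffunE; exact: scalerAl.
apply/idP/idP => [|vH].
- pose P (w : {ffun 'I_k -> L}) := (w : {ffun 'I_k -> L^o}) \in H.
  apply: (@span_subset F {ffun 'I_k -> L} P); rewrite /P.
  + exact: mem0v.
  + by move=> c x y xH yH; rewrite memvD // -[x](@scale1r L {ffun 'I_k -> L^o}) scE memvZ.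
  by move=> _ /allpairsP[[a b] /= [_ bH ->]]; apply: memvZ; exact: vbasis_mem.
- pose P (w : {ffun 'I_k -> L^o}) := (w : {ffun 'I_k -> L}) \in restr_scal H.
  have PD x y : P x -> P y -> P (x + y) by exact: memvD.
  have P0 : P 0 by exact: mem0v.
  rewrite -/(P v) (coord_vbasis vH).
  apply: (big_ind P) => // i _.
  set c := coord _ _ _.
  rewrite (coord_vbasis (memvf (c : L))) scaler_suml.
  apply: (big_ind P) => // j _.
  rewrite -scE; apply: memvZ; apply: memv_span.
  by apply: allpairs_f; apply: mem_nth; rewrite size_tuple.
Qed.

Definition evasive (h r : nat) (U : {vspace {ffun 'I_k -> L}}) : Prop :=
  forall H : {vspace {ffun 'I_k -> L^o}},
    \dim H = h -> (\dim (U :&: restr_scal H) <= r)%N.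

End Evasive.

Section VA.
Variables (F : finFieldType) (L : fieldExtType F) (q m : nat).
Variable A : 'I_m -> L.

(* Indices start at 0 (alpha_(i+1) is A i) and are cyclic: ordS and ord_pred  *)
(* are the successor and predecessor modulo m.                                *)
Definition K_A : L := \prod_(i < m) A i ^+ (q ^ ord_pred i).

Definition V_A_fun (x : {ffun 'I_m -> L}) : {ffun 'I_(m + m) -> L} :=
  [ffun i => match split i with
             | inl j => x j
             | inr j => x j ^+ q + A (ordS j) * x (ordS j) ^+ (q ^ 2)
             end].

(* linfun V_A_fun is V_A_fun only if the latter is F-linear, which is the     *)
(* case for q = #|F|: see V_A_fun_linear and mem_V_A.                         *)
Definition V_A : {vspace {ffun 'I_(m + m) -> L}} := limg (linfun V_A_fun).

Hypothesis qF : #|F| = q.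

Lemma expq_linear : linear (fun x : L => x ^+ q).
Proof.
move=> a x y /=; have [p pr_p pF] := finPcharP F.
have pL : p \in [pchar L] by rewrite pchar_lalg.
have [e qE] : exists e, q = (p ^ e)%N.
  by exists (logn p #|F|); rewrite -qF -(card_pprimeChar pF).
rewrite exprDn_pchar; last first.
  by rewrite qE pnatX pnatE // pL.
by rewrite exprZn -[in a ^+ q]qF expf_card.
Qed.

Lemma V_A_fun_linear : linear V_A_fun.
Proof.
move=> a x y; apply/ffunP=> i; rewrite !ffunE.
case: (split i) => j; rewrite !ffunE // -mulnn !exprM !expq_linear.
by rewrite mulrDr scalerDr -scalerAr addrACA.
Qed.

Lemma mem_V_A (v : {ffun 'I_(m + m) -> L}) :
  v \in V_A <-> exists x, v = V_A_fun x.
Proof.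
pose f := GRing.isLinear.Build _ _ _ _ V_A_fun V_A_fun_linear.
pose g : {linear _ -> _} := HB.pack V_A_fun f.
have E x : linfun V_A_fun x = V_A_fun x by exact: (lfunE g x).
split=> [/memv_imgP[x _ ->]|[x ->]]; first by exists x.
by rewrite -E memv_img ?memvf.
Qed.

End VA.

(* Main.v *)
(** Take a basis of [U :&: H], of size [d] say, and let the columns of [X] and
    [Y] hold the first and the last [m] coordinates of its vectors.  With [s]
    the entrywise [q]-Frobenius, [Y = s X + P s^2 X] for an invertible [P], and
    the space spanned by the rows of [X] and [Y] has dimension at most 2.  By
    Galois descent an [s]-stable space of rows is defined over F_q; as the
    columns of [X] are independent over F_q, every [s]-stable space containing
    the rows of [X] has dimension [d].  If [X] has rank 2, the rows of [Y]
    depend on those of [X], so the rows of [X] and [s X] span such a space,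
    and [d <= 4].  If [X = u l] has rank 1, the condition on [K_A] makes [s u]
    and [P s^2 u] independent, so [l], [s l] and [s^2 l] lie in a space of
    dimension 2, and [d <= 2]. *)
Require Import Defs.
From HB Require Import structures.
From mathcomp Require Import all_boot all_order all_algebra all_field.

Set Implicit Arguments.
Unset Strict Implicit.
Unset Printing Implicit Defensive.

Import GRing.Theory.
Local Open Scope ring_scope.

(** * Galois descent for the entrywise Frobenius *)

Section Frobenius.
Variables (F : finFieldType) (L : fieldExtType F).

Definition frob (x : L) : L := x ^+ #|F|.

Lemma frob_is_zmod_morphism : zmod_morphism frob.
Proof.
move=> x y; have := @expq_linear F L _ erefl (-1) y x.
by rewrite !scaleN1r ![- _ + _]addrC.
Qed.

Lemma frob_is_monoid_morphism : monoid_morphism frob.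
Proof. by split=> [|x y]; rewrite /frob ?expr1n ?exprMn. Qed.

HB.instance Definition _ :=
  GRing.isZmodMorphism.Build L L frob frob_is_zmod_morphism.
HB.instance Definition _ :=
  GRing.isMonoidMorphism.Build L L frob frob_is_monoid_morphism.

(** Over [F] the polynomial ['X^#|F| - 'X] is the product of the ['X - a] for [a] in [F], so it has
    no further root in [L]. *)
Lemma frob_fixed (x : L) : frob x = x -> exists a : F, x = a%:A.
Proof.
move=> xq; have /(congr1 (map_poly (in_alg L))) := finField_genPoly F.
rewrite rmorphB /= map_polyXn map_polyX rmorph_prod /= => E.
have : root ('X^#|F| - 'X) x.
  by rewrite /root !hornerE -/(frob x) xq subrr.
rewrite E rootE horner_prod prodf_seq_eq0 => /hasP[a _] /=.
rewrite rmorphB /= map_polyX map_polyC !hornerE subr_eq0 => /eqP ->.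
by exists a.
Qed.

Lemma frob_fixed_mx p d (Z : 'M[L]_(p, d)) :
  map_mx frob Z = Z -> exists G : 'M[F]_(p, d), Z = map_mx (in_alg L) G.
Proof.
move=> Zq; have fixZ i j : exists a : F, Z i j == a%:A.
  have [|a ->] := @frob_fixed (Z i j); last by exists a.
  by rewrite -[in RHS]Zq mxE.
exists (\matrix_(i, j) xchoose (fixZ i j)); apply/matrixP=> i j.
by rewrite !mxE; apply/eqP/(xchooseP (fixZ i j)).
Qed.

(** Linear independence over [F] of the columns of [Z], although their entries lie in [L]. *)
Definition base_free p d (Z : 'M[L]_(p, d)) :=
  forall c : 'cV[F]_d, Z *m map_mx (in_alg L) c = 0 -> c = 0.

Lemma base_freeS p1 p2 d (Z1 : 'M[L]_(p1, d)) (Z2 : 'M[L]_(p2, d)) :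
  (Z1 <= Z2)%MS -> base_free Z1 -> base_free Z2.
Proof.
by move=> /submxP[D ->] Zf c Zc0; apply: Zf; rewrite -mulmxA Zc0 mulmx0.
Qed.

(* A basis of the row space normalized to be the identity on a choice of
   pivot columns is fixed by Frobenius, hence defined over F. *)
Lemma frob_stable_rank p d (Z : 'M[L]_(p, d)) :
  (map_mx frob Z <= Z)%MS -> base_free Z -> \rank Z = d.
Proof.
move=> sZ Zf; have fullB : row_full (row_base Z)^T.
  by rewrite /row_full mxrank_tr; exact: row_base_free.
set f := fullrankfun fullB; set C := colsub f (row_base Z).
have unitC : C \in unitmx.
  by rewrite -unitmx_tr trmx_mxsub; exact: fullrowsub_unit.
set E := invmx C *m row_base Z.
have EZ : (E :=: Z)%MS.
  apply: eqmx_trans (eq_row_base Z).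
  by apply: eqmxMfull; rewrite row_full_unit unitmx_inv.
have fE : colsub f E = 1%:M by rewrite -mulmx_colsub mulVmx.
have /submxP[D EqE] : (map_mx frob E <= E)%MS.
  by rewrite EZ (submx_trans _ sZ) // map_submx EZ.
have D1 : D = 1%:M.
  rewrite -[D]mulmx1 -fE mulmx_colsub -EqE.
  by rewrite -map_mxsub fE map_mx1.
have [|G defG] := @frob_fixed_mx _ _ E; first by rewrite EqE D1 mul1mx.
have Gf : base_free (map_mx (in_alg L) G).
  by apply: base_freeS Zf; rewrite -defG EZ.
(* Each column of [cokermx G] is a relation over [F] between the columns of [G], so it vanishes by
   [Gf]. *)
have coG : cokermx G = 0.
  apply/matrixP=> i j; have /colP/(_ i) : col j (cokermx G) = 0.
    by apply: Gf; rewrite -map_mxM colE mulmxA mulmx_coker mul0mx map_mx0.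
  by rewrite !mxE.
have : \rank (cokermx G) = 0%N by rewrite coG mxrank0.
rewrite mxrank_coker => /eqP; rewrite subn_eq0 => dG.
apply/eqP; rewrite eqn_leq rank_leq_col /=.
by rewrite -EZ defG mxrank_map.
Qed.

End Frobenius.

(** * The cyclic shift weighted by [A] *)

Section ShiftMatrix.
Variables (F : finFieldType) (L : fieldExtType F) (m : nat) (A : 'I_m -> L).

Definition shift_mx : 'M[L]_m := \matrix_(j, k) (A k *+ (k == ordS j)).

Lemma shift_mxE d (Z : 'M[L]_(m, d)) j i :
  (shift_mx *m Z) j i = A (ordS j) * Z (ordS j) i.
Proof.
rewrite mxE (bigD1 (ordS j)) //= big1 => [|k /negPf jk].
  by rewrite !mxE eqxx addr0.
by rewrite !mxE jk mul0r.
Qed.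

Hypothesis A_neq0 : forall i, A i != 0.

Lemma shift_mx_full : row_full shift_mx.
Proof.
apply/row_fullP; exists (\matrix_(k, j) ((A k)^-1 *+ (k == ordS j))).
apply/matrixP=> k l; rewrite mxE (bigD1 (ord_pred k)) //= big1 => [|j kj].
  rewrite !mxE ord_predK eqxx addr0 [l == k]eq_sym.
  by case: eqP => [->|_]; rewrite ?mulr0 ?mulVf.
rewrite !mxE (_ : (k == ordS j) = false) ?mul0r //.
by apply/negbTE; apply: contraNneq kj => ->; rewrite ordSK.
Qed.

End ShiftMatrix.

Lemma val_iter_ordS m (i : 'I_m) k :
  val (iter k (@ordS m) i) = ((i + k) %% m)%N.
Proof.
elim: k => [|k IHk]; first by rewrite addn0 modn_small.
by rewrite iterS /= IHk -addn1 modnDml addn1 addnS.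
Qed.

Lemma iter_ordS_transitive m (i j : 'I_m) : exists k, iter k (@ordS m) i = j.
Proof.
exists (j + (m - i))%N; apply: val_inj; rewrite val_iter_ordS.
by rewrite addnCA subnKC 1?ltnW // modnDr modn_small.
Qed.

(** * The use of the condition on [K_A] *)

Section TwistedCycle.
Variables (F : finFieldType) (L : fieldExtType F) (m : nat) (A : 'I_m -> L).
Let q := #|F|.
Hypothesis K_A_nopower :
  ~ exists b : L, K_A q A = b ^+ (\sum_(i < m) q ^ i)%N.

(** By cyclicity a nonzero [v] has no zero entry. Raise the [j]-th relation to the power [q ^ j],
    multiply, and cancel the factors common to both sides: with [v0 = v ord0] and
    [s = 1 + q + ... + q^(m-1)], this leaves [v0 = e^s K_A v0^(q^m)]. Since [q^m = (q - 1) s + 1],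
    [K_A] is the [s]-th power of the inverse of [e v0^(q-1)]. *)
Lemma twisted_cycle_eq0 (e : L) (v : 'I_m -> L) :
  (forall j, v j = e * A (ordS j) * v (ordS j) ^+ q) -> forall j, v j = 0.
Proof.
have q_gt0 : (0 < q)%N by apply/card_gt0P; exists 0.
move=> vE j; apply/eqP; case: (eqVneq (v j) 0) => // vj.
have v_neq0 i : v i != 0.
  have [k <-] := iter_ordS_transitive j i.
  elim: k => //= k; rewrite vE; apply: contraNneq => ->.
  by rewrite expr0n -(prednK q_gt0) mulr0.
case: m A K_A_nopower v vE v_neq0 j {vj} => [? ? ? ? ? []//|m' B K_nopower v vE v_neq0 _].
set s := (\sum_(i < m'.+1) q ^ i)%N in K_nopower.
have KE : K_A q B = \prod_(j < m'.+1) B (ordS j) ^+ (q ^ j).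
  rewrite /K_A (reindex_inj (@ordS_inj _)); apply: eq_bigr => i _.
  by rewrite ordSK.
have eqs : \prod_(j < m'.+1) v j ^+ (q ^ j) =
    e ^+ s * K_A q B * \prod_(j < m'.+1) v (ordS j) ^+ (q ^ j.+1).
  rewrite KE /s expr_sum -!big_split; apply: eq_bigr => i _ /=.
  by rewrite {1}vE !exprMn -exprM expnS.
set R := \prod_(i < m') v (lift ord0 i) ^+ (q ^ i.+1).
have R_neq0 : R != 0 by apply/prodf_neq0 => i _; rewrite expf_neq0.
have shifted : \prod_(j < m'.+1) v (ordS j) ^+ (q ^ j.+1) =
    v ord0 ^+ (q ^ m'.+1) * R.
  rewrite big_ord_recr mulrC /=; congr (_ * _).
    apply: eq_bigr => i _; congr (v _ ^+ _); apply: val_inj => /=.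
    by rewrite modn_small // ltnS.
  by congr (v _ ^+ _); apply: val_inj; exact: modnn.
have qmE : (q ^ m'.+1 = (q.-1 * s).+1)%N.
  by rewrite /s -predn_exp prednK // expn_gt0 q_gt0.
case: K_nopower; exists (e * v ord0 ^+ q.-1)^-1.
move: eqs; rewrite shifted big_ord_recl expn0 expr1 -/R mulrA => /(mulIf R_neq0).
rewrite qmE exprSr mulrA -{1}[v ord0]mul1r => /(mulIf (v_neq0 _)) eq1.
have {}eq1 : K_A q B * (e * v ord0 ^+ q.-1) ^+ s = 1.
  by rewrite exprMn -exprM mulrCA mulrA -eq1.
rewrite exprVn -[RHS]mul1r -eq1 mulfK //.
by apply/eqP => z; move: eq1; rewrite z mulr0 => /esym/eqP; rewrite oner_eq0.
Qed.

End TwistedCycle.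

Lemma row_full_row_mx2 (K : fieldType) m (a b : 'cV[K]_m) :
  b != 0 -> (forall e, a != e *: b) -> row_full (row_mx a b).
Proof.
move=> b_neq0 neq_ab.
rewrite /row_full -mxrank_tr; apply: inj_row_free => v.
rewrite tr_row_mx -[v]hsubmxK mul_row_col.
rewrite [lsubmx v]mx11_scalar [rsubmx v]mx11_scalar !mul_scalar_mx.
set c := lsubmx v 0 0; set e := rsubmx v 0 0.
rewrite -!linearZ -linearD => /(congr1 trmx); rewrite trmxK trmx0 => ab0.
have c0 : c = 0.
  apply/eqP/negPn/negP => c_neq0; have /eqP[] := neq_ab (- (c^-1 * e)).
  rewrite scaleNr -scalerA -(addr0_eq ab0) scalerN opprK.
  by rewrite scalerA mulVf ?scale1r.
move/eqP: ab0; rewrite c0 scale0r add0r scaler_eq0 (negPf b_neq0) orbF => /eqP->.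
by rewrite !raddf0 row_mx0.
Qed.

(** * Bounding the number of columns of [X] *)

Section MatrixBound.
Variables (F : finFieldType) (L : fieldExtType F) (m d : nat) (A : 'I_m -> L).
Let q := #|F|.
Local Notation s := (map_mx (@frob F L)).
Let P := shift_mx A.

Hypothesis A_neq0 : forall i, A i != 0.
Hypothesis K_A_nopower :
  ~ exists b : L, K_A q A = b ^+ (\sum_(i < m) q ^ i)%N.

Variable X : 'M[L]_(m, d).
Hypothesis X_free : base_free X.
Let Y := s X + P *m s (s X).
Hypothesis rankXY : (\rank (X + Y)%MS <= 2)%N.

Lemma rank2_bound : \rank X = 2 -> (d <= 4)%N.
Proof.
move=> rX; have YX : (Y <= X)%MS.
  rewrite (submx_trans (addsmxSr X Y)) //.
  by rewrite -(geq_leqif (mxrank_leqif_sup (addsmxSl X Y))) rX.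
have ssX : (s (s X) <= X + s X)%MS.
  (* [P] is invertible, so [s (s X)] has the same row space as [P *m s (s X) = Y - s X]. *)
  rewrite -(eqmxMfull (s (s X)) (shift_mx_full A_neq0)).
  rewrite -[P *m _](addKr (s X)) addrC addmx_sub //.
    by rewrite (submx_trans YX) ?addsmxSl.
  by rewrite eqmx_opp addsmxSr.
rewrite -(@frob_stable_rank F L _ _ (X + s X)%MS).
- by rewrite (leq_trans (mxrank_adds_leqif _ _)) // mxrank_map rX.
- by rewrite map_addsmx addsmx_sub addsmxSr.
by apply: base_freeS X_free; exact: addsmxSl.
Qed.

Lemma rank1_bound : \rank X = 1 -> (d <= 4)%N.
Proof.
move=> rX; set l := nz_row X.
have X_neq0 : X != 0 by rewrite -mxrank_eq0 rX.
have l_neq0 : l != 0 by rewrite nz_row_eq0.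
have lX : (l <= X)%MS by exact: nz_row_sub.
have Xl : (X <= l)%MS.
  by rewrite -(geq_leqif (mxrank_leqif_sup lX)) rX rank_rV l_neq0.
have l_free : base_free l by apply: base_freeS X_free.
have [u XE] := submxP Xl.
have su_neq0 : s u != 0.
  by rewrite map_mx_eq0; apply: contraNneq X_neq0 => u0; rewrite XE u0 mul0mx.
have YE : Y = row_mx (s u) (P *m s (s u)) *m col_mx (s l) (s (s l)).
  rewrite mul_row_col /Y XE (map_mxM (@frob F L) u l).
  by rewrite (map_mxM (@frob F L) (s u) (s l)) mulmxA.
have fullW : row_full (row_mx (s u) (P *m s (s u))).
  apply: row_full_row_mx2 => [|e].
    apply: contra_neq su_neq0 => Pssu0.
    have /eqP : s (s u) = 0.
      by apply: (row_full_inj (shift_mx_full A_neq0)); rewrite Pssu0 mulmx0.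
    by rewrite map_mx_eq0 => /eqP.
  (* Entrywise, [s u = e P s^2 u] is the cyclic system of [twisted_cycle_eq0] for [s u]. *)
  apply: contra_neq su_neq0 => suE; apply/colP=> j; rewrite [RHS]mxE.
  apply: (twisted_cycle_eq0 K_A_nopower (e := e)) (s u ^~ 0) _ j => i.
  by rewrite {1}suE mxE shift_mxE mulrA [s (s u) _ _]mxE.
(* By [fullW], the rows of [Y] span the same space as [s l] and [s (s l)]. *)
have sll : (l + (s l + s (s l)) <= X + Y)%MS.
  by rewrite YE addsmxS // addsmxE eqmxMfull.
have rl : (\rank (l + (s l + s (s l)))%MS <= 2)%N.
  exact: leq_trans (mxrankS sll) rankXY.
have [sl | nsl] := boolP (s l <= l)%MS.
  by rewrite -(frob_stable_rank sl l_free) rank_rV; case: (l != 0).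
have rll : (1 < \rank (l + s l)%MS)%N.
  have := ltn_leqif (mxrank_leqif_sup (addsmxSl l (s l))).
  by rewrite addsmx_sub submx_refl (negPf nsl) rank_rV l_neq0.
(* By [rll] and [rl], adding [s (s l)] to the span of [l] and [s l] cannot raise its rank, which is
   already 2. *)
have stable : (s (l + s l)%MS <= l + s l)%MS.
  rewrite map_addsmx addsmx_sub addsmxSr /=.
  have le : (l + s l <= l + (s l + s (s l)))%MS by rewrite addsmxS ?addsmxSl.
  apply: submx_trans (_ : l + (s l + s (s l)) <= _)%MS.
    by rewrite (submx_trans (addsmxSr (s l) _)) ?addsmxSr.
  by rewrite -(geq_leqif (mxrank_leqif_sup le)) (leq_trans rl).
rewrite -(frob_stable_rank stable) //; last first.
  by apply: base_freeS l_free; exact: addsmxSl.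
by rewrite (leq_trans (mxrank_adds_leqif _ _)) // mxrank_map rank_rV l_neq0.
Qed.

Lemma columns_bound : (d <= 4)%N.
Proof.
have : (\rank X <= 2)%N by exact: leq_trans (mxrankS (addsmxSl X Y)) rankXY.
case E: (\rank X) => [|[|[|]]] // _; [|exact: rank1_bound|exact: rank2_bound].
(* In rank 0 the zero space is stable, which forces [d = 0]. *)
have X0 : X = 0 by apply/eqP; rewrite -mxrank_eq0 E.
by rewrite -(frob_stable_rank _ X_free) ?E // X0 map_mx0 sub0mx.
Qed.

End MatrixBound.

(** * Translation of evasiveness into the matrix bound *)

Theorem theorem3p3 (q n m : nat) (F : finFieldType) (L : fieldExtType F)
    (hq : #|F| = q) (hn : \dim {:L} = n) (hm : (3 <= m)%N)
    (A : 'I_m -> L) (hA : forall i, A i != 0)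
    (hK : ~ exists b : L, K_A q A = b ^+ (\sum_(i < m) q ^ i)%N) :
  evasive 2 4 (V_A q A).
Proof.
move=> H dimH; set W := (_ :&: _)%VS; set b := vbasis W.
pose X : 'M[L]_(m, \dim W) := \matrix_(j, i) b`_i (lshift m j).
pose s r := map_mx (@frob F L) : 'M_(m, r) -> 'M_(m, r).
have inV w : w \in W -> exists x, w = V_A_fun q A x.
  by rewrite memv_cap => /andP[/(mem_V_A A hq)].
have bW (i : 'I_(\dim W)) : b`_i \in W.
  by apply: vbasis_mem; rewrite mem_nth ?size_tuple.
have col_bE : col_mx X (s _ X + shift_mx A *m s _ (s _ X)) =
    \matrix_(k, i) b`_i k.
  apply/matrixP=> k i; rewrite !mxE.
  have [x bE] := inV _ (bW i).
  case: splitP => j kE.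
    by rewrite mxE; congr (_ _ _); apply: val_inj.
  have -> : k = rshift m j by exact: val_inj.
  rewrite mxE shift_mxE !mxE bE !ffunE.
  rewrite -[lshift _ _]/(unsplit (inl _)) -[rshift _ _]/(unsplit (inr _)).
  by rewrite -[lshift _ (ordS j)]/(unsplit (inl _)) !unsplitK /frob hq -exprM.
apply: (@columns_bound F L m _ A hA _ X); rewrite ?hq //.
  (* A vector of [V_A] is determined by its first [m] coordinates, so a relation over [F] between
     the columns of [X] also holds between the basis vectors. *)
  move=> c Xc0.
  pose w := \sum_i c i 0 *: b`_i.
  have wW : w \in W by apply: memv_suml => i _; apply: memvZ.
  have [x wE] := inV _ wW.
  have x0 : x = 0.
    apply/ffunP=> j; have /colP/(_ j) := Xc0; rewrite !mxE ffunE => <-.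
    have -> : x j = w (lshift m j).
      by rewrite wE ffunE -[lshift _ _]/(unsplit (inl _)) unsplitK.
    rewrite /w sum_ffunE; apply: eq_bigr => i _.
    by rewrite !mxE ffunE mulr_algr.
  have w0 : w = 0.
    have q0 : (q == 0)%N = false.
      by apply/negbTE; rewrite -lt0n -hq; apply/card_gt0P; exists 0.
    rewrite wE x0; apply/ffunP=> k; rewrite !ffunE.
    by case: split => j; rewrite !ffunE ?expr0n ?expn_eq0 ?q0 ?mulr0 ?addr0.
  have := basis_free (vbasisP W) => /freeP/(_ (fun i => c i 0) w0) c0.
  by apply/colP=> i; rewrite c0 mxE.
rewrite addsmxE col_bE.
pose h := vbasis H.
(* The basis vectors lie in [H]; their coordinates there factor the matrix over [L] through
   dimension [\dim H = 2]. *)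
have -> : \matrix_(k, i) b`_i k =
  (\matrix_(k < m + m, t < \dim H) (h`_t : {ffun 'I_(m + m) -> L^o}) k) *m
  (\matrix_(t < \dim H, i < \dim W) coord h t b`_i) :> 'M[L]_(_, _).
  apply/matrixP=> k i; rewrite !mxE.
  have bH : (b`_i : {ffun 'I_(m + m) -> L^o}) \in H.
    by rewrite -mem_restr_scal; have := bW i; rewrite memv_cap => /andP[].
  rewrite {1}(coord_vbasis bH) sum_ffunE; apply: eq_bigr => t _.
  by rewrite ffunE !mxE mulrC.
by rewrite -dimH mulmx_max_rank.
Qed.
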